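(* Let $(x^k)$ be generated by the variational-equilibrium augmented Lagrangian method described below, where each step satisfies the inexactness assumption described below with $\varepsilon_k\downarrow 0$, and let $\bar x$ be a limit point of $(x^k)$. Assume that the constraints admit feasible points (points $x$ with $g(x)\le0$, $h(x)\le0$) and that the function $x\mapsto(g(x),h(x))$ satisfies (classical) CPLD in $\bar x$. Then $\bar x$ is feasible and solves the GNEP.
   Context: GNEP with shared constraints (jointly-convex): $N$ players, $x=(x^1,\ldots,x^N)\in\mathbb{R}^n$, $x^\nu\in\mathbb{R}^{n_\nu}$, $x=(x^\nu,x^{-\nu})$; player $\nu$ solves $\min_{x^\nu}\theta_\nu(x)$ s.t. $g(x)\le0$, $h(x)\le0$, where $\theta_\nu:\mathbb{R}^n\to\mathbb{R}$, $g:\mathbb{R}^n\to\mathbb{R}^m$, $h:\mathbb{R}^n\to\mathbb{R}^p$ are continuously differentiable, all components of $g,h$ are convex, and each $\theta_\nu(\cdot,x^{-\nu})$ is convex for every fixed $x^{-\nu}$. A solution of the GNEP is a point $\bar x$ with $g(\bar x)\le 0$, $h(\bar x)\le0$ such that for each $\nu$, $\theta_\nu(\bar x)\le\theta_\nu(x^\nu,\bar x^{-\nu})$ for all $x^\nu$ with $g(x^\nu,\bar x^{-\nu})\le0$, $h(x^\nu,\bar x^{-\nu})\le0$. Notation: $v_+=\max\{0,v\}$ componentwise; $\nabla f$ = transposed Jacobian, $\nabla_{x^\nu}f$ its rows for $x^\nu$; $\min$ componentwise; Euclidean norms. Augmented Lagrangian of player $\nu$: $L_a^\nu(x,u;\rho)=\theta_\nu(x)+\frac{\rho}{2}\|(g(x)+u/\rho)_+\|^2$.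 Method: choose $u^{\max}\ge0$, $\tau\in(0,1)$, $\gamma>1$, $\rho_0>0$, $x^0\in\mathbb{R}^n$, $\lambda^0\in\mathbb{R}^m$, $\mu^0\in\mathbb{R}^p$, $u^0\in[0,u^{\max}]^m$. For $k=0,1,2,\dots$ (assumed to run forever): (1) compute $(x^{k+1},\mu^{k+1})\in\mathbb{R}^{n+p}$ satisfying the inexactness assumption; (2) $\lambda^{k+1}=(u^k+\rho_kg(x^{k+1}))_+$; (3) if $\|\min\{-g(x^{k+1}),\lambda^{k+1}\}\|\le\tau\|\min\{-g(x^k),\lambda^k\}\|$ set $\rho_{k+1}=\rho_k$, else $\rho_{k+1}=\gamma\rho_k$; (4) $u^{k+1}=\min\{\lambda^{k+1},u^{\max}\}$ componentwise. Inexactness assumption: for all $k$ and every $\nu$, $\|\nabla_{x^\nu}L_a^\nu(x^{k+1},u^k;\rho_k)+\nabla_{x^\nu}h(x^{k+1})\mu^{k+1}\|\le\varepsilon_k$ and $\|\min\{-h(x^{k+1}),\mu^{k+1}\}\|\le\varepsilon'_k$, with $(\varepsilon_k),(\varepsilon'_k)\subset[0,\infty)$, $\varepsilon'_k\to0$. Classical CPLD for $G=(g,h):\mathbb{R}^n\to\mathbb{R}^{m+p}$ at $x$ with $G(x)\le0$: whenever $\nabla G_i(x)$, $i\in I$, are positively linearly dependent (a nontrivial nonnegative combination vanishes) for some $I\subset\{i:G_i(x)=0\}$, the gradients $\nabla G_i(y)$, $i\in I$, are linearly dependent for all $y$ in a neighbourhood of $x$. *)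

(* Defs.v *)
From HB Require Import structures.
From mathcomp Require Import all_boot all_order all_algebra.
From mathcomp Require Import all_classical all_reals all_analysis.
Set Implicit Arguments. Unset Strict Implicit. Unset Printing Implicit Defensive.
Import Order.TTheory GRing.Theory Num.Theory.
Import numFieldNormedType.Exports.
Local Open Scope classical_set_scope.
Local Open Scope ring_scope.

Section GNEP.
Variable R : realType.

Definition unitv (n : nat) (j : 'I_n) : 'rV[R]_n := delta_mx 0 j.

Definition pd (n : nat) (f : 'rV[R]_n -> R) (x : 'rV[R]_n) (j : 'I_n) : R :=
  'd f x (unitv j).

Definition C1 (n : nat) (f : 'rV[R]_n -> R) : Prop :=
  (forall x, differentiable f x) /\ (forall j, continuous (fun x => pd f x j)).

Definition convex_fun (n : nat) (f : 'rV[R]_n -> R) : Prop :=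
  forall (x y : 'rV[R]_n) (t : R), 0 <= t -> t <= 1 ->
    f (t *: x + (1 - t) *: y) <= t * f x + (1 - t) * f y.

Definition enorm_on (I : finType) (P : pred I) (v : I -> R) : R :=
  Num.sqrt (\sum_(i | P i) v i ^+ 2).
Definition enorm (I : finType) (v : I -> R) : R := enorm_on predT v.

(* x and y differ at most in the block of player nu;
   blk j is the player owning coordinate j *)
Definition same_off (n N : nat) (blk : 'I_n -> 'I_N) (nu : 'I_N)
  (x y : 'rV[R]_n) : Prop := forall j, blk j != nu -> x 0 j = y 0 j.

Definition convex_in_block (n N : nat) (blk : 'I_n -> 'I_N) (nu : 'I_N)
  (f : 'rV[R]_n -> R) : Prop :=
  forall (x y : 'rV[R]_n) (t : R), same_off blk nu x y -> 0 <= t -> t <= 1 ->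
    f (t *: x + (1 - t) *: y) <= t * f x + (1 - t) * f y.

Definition feasible (n m p : nat) (g : 'I_m -> 'rV[R]_n -> R)
  (h : 'I_p -> 'rV[R]_n -> R) (x : 'rV[R]_n) : Prop :=
  (forall i, g i x <= 0) /\ (forall l, h l x <= 0).

Definition GNEP_solution (n N m p : nat) (blk : 'I_n -> 'I_N)
  (theta : 'I_N -> 'rV[R]_n -> R) (g : 'I_m -> 'rV[R]_n -> R)
  (h : 'I_p -> 'rV[R]_n -> R) (xb : 'rV[R]_n) : Prop :=
  feasible g h xb /\
  forall nu y, same_off blk nu y xb -> feasible g h y -> theta nu xb <= theta nu y.

Definition La (n N m : nat) (theta : 'I_N -> 'rV[R]_n -> R)
  (g : 'I_m -> 'rV[R]_n -> R) (nu : 'I_N) (u : 'I_m -> R) (rho : R)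
  (x : 'rV[R]_n) : R :=
  theta nu x + rho / 2 * \sum_i (Num.max 0 (g i x + u i / rho)) ^+ 2.

Definition Gmap (n m p : nat) (g : 'I_m -> 'rV[R]_n -> R)
  (h : 'I_p -> 'rV[R]_n -> R) (i : 'I_(m + p)) : 'rV[R]_n -> R :=
  match fintype.split i with inl i' => g i' | inr l => h l end.

(* classical CPLD of G at x: for every subset I of the active indices
   whose gradients are positively linearly dependent at x, the gradients
   are linearly dependent at every y in a neighbourhood of x.
   (Feasibility of x is NOT built in.) *)
Definition CPLD (n q : nat) (G : 'I_q -> 'rV[R]_n -> R) (x : 'rV[R]_n) : Prop :=
  forall I : {set 'I_q},
    (forall i, i \in I -> G i x = 0) ->
    (exists a : 'I_q -> R,
        (forall i, i \in I -> 0 <= a i) /\ (exists2 i, i \in I & a i != 0) /\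
        (forall j, \sum_(i in I) a i * pd (G i) x j = 0)) ->
    \forall y \near x, exists a : 'I_q -> R,
        (exists2 i, i \in I & a i != 0) /\
        (forall j, \sum_(i in I) a i * pd (G i) y j = 0).

End GNEP.

(* Main.v *)
(** Complementarity forces the multipliers of the constraints that are inactive
at [xb] to vanish in the limit, so both the gradient of the Lagrangian and its
quotient by [rho k] say that some convergent sequence of vectors lies in the
cones generated by the gradients, at [x k.+1], of the constraints active at
[xb].  CPLD makes this cone-valued map outer semicontinuous at [xb]: after a
Caratheodory reduction the generators can be taken linearly independent, and
if the multipliers were unbounded their normalized limit would be a positive
linear dependence at [xb], hence a dependence nearby.  Applied to the quotient
by [rho k] when [rho] is unbounded, this makes [xb] a KKT point of a convex
program minimizing [||g_+||^2 / 2], whose minimum is [0], so [xb] is feasible;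
applied to the Lagrangian itself it gives KKT multipliers at [xb] common to
all players, which suffice by convexity. *)
Require Import Defs.
From HB Require Import structures.
From mathcomp Require Import all_boot all_order all_algebra.
From mathcomp Require Import all_classical all_reals all_analysis.
From mathcomp Require Import ring lra.
Import Order.TTheory GRing.Theory Num.Theory.
Import numFieldNormedType.Exports.
Local Open Scope classical_set_scope.
Local Open Scope ring_scope.

(** * Caratheodory reduction for cones *)

(** Induction on the size of the support of [a]: as long as the generators in the support are
    dependent, moving along a dependence cancels one coefficient without changing the
    combination. *)
Lemma conic_caratheodory (R : realFieldType) (q n : nat)
    (w : 'I_q -> 'I_n -> R) (a : 'I_q -> R) :
  (forall i, 0 <= a i) ->
  exists b : 'I_q -> R,
    [/\ forall i, 0 <= b i,
        forall i, a i = 0 -> b i = 0,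
        forall j, \sum_i b i * w i j = \sum_i a i * w i j
      & forall c : 'I_q -> R,
          (exists2 i, i \in [set i | b i != 0]%SET & c i != 0) ->
          ~ (forall j, \sum_(i in [set i | b i != 0]%SET) c i * w i j = 0)].
Proof.
have [k] := ubnP #|[set i | a i != 0]%SET|.
elim: k a => // k IH a; rewrite ltnS => le_k a0.
set S := [set i | a i != 0]%SET in le_k.
have [[c [[i0 i0S ci0] c0]]|nodep] := pselect (exists c : 'I_q -> R,
    (exists2 i, i \in S & c i != 0) /\
    (forall j, \sum_(i in S) c i * w i j = 0)); last first.
  by exists a; split=> // c ci cj; apply: nodep; exists c.
(* Up to a change of sign the dependence has a positive entry, so the ratio test below has a
   candidate. *)
wlog ci0_gt0 : c ci0 c0 / 0 < c i0.
  move=> wl; have [/wl|] := ltP 0 (c i0); first exact.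
  rewrite le_eqVlt (negPf ci0)/= => ci0_lt0.
  apply: (wl (fun i => - c i)); rewrite ?oppr_eq0 ?oppr_gt0// => j.
  by under eq_bigr do rewrite mulNr; rewrite sumrN c0 oppr0.
have Pi0 : (i0 \in S) && (0 < c i0) by rewrite i0S.
(* Ratio test: [a i1 / c i1] is the largest [t] for which [a - t c] stays nonnegative, and the entry
   at [i1] then vanishes. *)
pose i1 := [arg min_(i < i0 | (i \in S) && (0 < c i)) (a i / c i)]%O.
have [/andP[i1S ci1] i1min] : ((i1 \in S) && (0 < c i1)) /\
    (forall i, (i \in S) && (0 < c i) -> a i1 / c i1 <= a i / c i).
  by rewrite /i1; case: arg_minP => [|i Pi H]; last split.
pose t := a i1 / c i1.
have t0 : 0 <= t by rewrite divr_ge0// ltW.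
pose a' i := if i \in S then a i - t * c i else 0.
have aS i : i \notin S -> a i = 0 by rewrite inE negbK => /eqP.
have [|i|b [b0 ba bw bI]] := IH a'.
- apply: leq_trans le_k; apply: proper_card; apply/properP; split.
    by apply/fintype.subsetP => i; rewrite !inE /a' inE; case: ifP => //;
      rewrite eqxx.
  exists i1 => //; rewrite inE negbK /a' i1S /t divfK ?subrr// gt_eqF//.
- rewrite /a'; case: ifPn => // iS; rewrite subr_ge0.
  have [ci|ci] := ltP 0 (c i).
    by rewrite -ler_pdivlMr// i1min// iS.
  by apply: le_trans (a0 i); rewrite mulr_ge0_le0.
- exists b; split=> //.
    move=> i ai; apply: ba; rewrite /a' ifN// inE ai eqxx//.
  move=> j; rewrite bw (bigID [in S])/= [X in _ + X]big1 ?addr0; last first.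
    by move=> i iS; rewrite /a' (negPf iS) mul0r.
  rewrite [RHS](bigID [in S])/= [X in _ = _ + X]big1 ?addr0; last first.
    by move=> i iS; rewrite (aS _ iS) mul0r.
  transitivity (\sum_(i in S) (a i * w i j - t * (c i * w i j))).
    by apply: eq_bigr => i iS; rewrite /a' iS mulrBl mulrA.
  by rewrite sumrB -mulr_sumr c0 mulr0 subr0.
Qed.

(** * Limits along ultrafilters, in place of subsequence extraction *)

(** Compactness gives a cluster point of the image, and an ultrafilter converges to each of its
    cluster points. *)
Lemma ultra_bounded_cvg (R : realType) (T : Type) (U : set_system T)
    (UU : UltraFilter U) (f : T -> R) (a b : R) :
  (forall k, a <= f k <= b) -> exists l : R, f @ U --> l.
Proof.
move=> fab.
have FU : U (f @^-1` `[a, b]).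
  by apply: filterE => k /=; rewrite in_itv/= fab.
have [l [_ cl]] := @segment_compact R a b (f @ U) (fmap_proper_filter f _) FU.
exists l => A Al.
have [//|UnA] := in_ultra_setVsetC (f @^-1` A) UU.
by have [y []] := cl (~` A) A UnA Al.
Qed.

(** Pigeonhole: otherwise the complements of the finitely many fibres would all be in [U], and so
    would their empty intersection. *)
Lemma ultra_finite_choice (T : Type) (I : finType) (U : set_system T)
    (UU : UltraFilter U) (f : T -> I) : exists i, \forall k \near U, f k = i.
Proof.
apply: contrapT => /forallNP H.
have : \forall k \near U, forall i, i \in I -> f k <> i.
  apply: filter_forall => i.
  have [Ui|Ui] := in_ultra_setVsetC [set k | f k = i] UU; first by case: (H i).
  by apply: filterS Ui => k /= ? _.
by case/filter_ex => k /(_ (f k)); apply.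
Qed.

Lemma cvgr_unique (R : realType) (T : Type) (F : set_system T)
    (FF : ProperFilter F) (f : T -> R) (a b : R) :
  f @ F --> a -> f @ F --> b -> a = b.
Proof. by move=> fa fb; exact: (cvg_unique (@norm_hausdorff R R^o) fa fb). Qed.

Lemma cvg_sumr (R : realType) (T : Type) (F : set_system T) (FF : Filter F)
    (I : Type) (r : seq I) (P : pred I) (f : I -> T -> R) (l : I -> R) :
  (forall i, P i -> f i @ F --> l i) ->
  (fun k => \sum_(i <- r | P i) f i k) @ F --> \sum_(i <- r | P i) l i.
Proof. by move=> fl; apply: cvg_big => //; apply: add_continuous. Qed.

(** * Closedness of the cones of active gradients under CPLD *)

Lemma CPLD_cone_closed (R : realType) (n q : nat) (G : 'I_q -> 'rV[R]_n -> R)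
    (xb : 'rV[R]_n) (T : Type) (F : set_system T) (FF : ProperFilter F)
    (y : T -> 'rV[R]_n) (a : T -> 'I_q -> R) (v : 'I_n -> R) :
  (forall i, C1 (G i)) -> CPLD G xb -> y @ F --> xb ->
  (forall k i, 0 <= a k i) ->
  (forall k i, G i xb != 0 -> a k i = 0) ->
  (forall j, (fun k => \sum_i a k i * pd (G i) (y k) j) @ F --> v j) ->
  exists b : 'I_q -> R,
    [/\ forall i, 0 <= b i,
        forall i, G i xb != 0 -> b i = 0
      & forall j, \sum_i b i * pd (G i) xb j = v j].
Proof.
move=> GC1 Gcpld yxb a0 aact av.
have [U [UU FU]] := ultraFilterLemma FF.
have UP : ProperFilter U := @ultra_proper _ _ UU.
have yU : y @ U --> xb by move=> A /yxb; exact: FU.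
have pdU i j : (fun k => pd (G i) (y k) j) @ U --> pd (G i) xb j.
  by exact: cvg_comp yU ((GC1 i).2 j xb).
have /choice[b bP] := fun k =>
  conic_caratheodory _ _ _ (fun i j => pd (G i) (y k) j) (a k) (a0 k).
have b0 k i : 0 <= b k i by case: (bP k).
have bact k i : G i xb != 0 -> b k i = 0.
  by move=> /(aact k); case: (bP k) => _ + _ _; apply.
(* There are finitely many supports, so one set [I] is the support of [b k] for [U]-almost all
   [k]. *)
have [I UI] := ultra_finite_choice _ _ _ UU
  (fun k => [set i | b k i != 0]%SET).
(* Scaling by [s k] gives [(1, b k)] total mass 1: every entry lies in [[0, 1]], hence converges
   along [U], and the limit [(s', c)] still has mass 1. Unbounded multipliers correspond to
   [s' = 0]. *)
pose s k := (1 + \sum_i b k i)^-1.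
have sb0 k : 0 <= \sum_i b k i by apply: sumr_ge0.
have s_gt0 k : 0 < s k by rewrite invr_gt0 ltr_wpDr.
have [s' s'P] : exists l : R, s @ U --> l.
  apply: (ultra_bounded_cvg _ _ _ UU s 0 1) => k.
  by rewrite ltW//= invf_le1 ?ltr_wpDr// lerDl.
have /choice[c cP] : forall i, exists l : R, (fun k => s k * b k i) @ U --> l.
  move=> i; apply: (ultra_bounded_cvg _ _ _ UU _ 0 1) => k.
  apply/andP; split; first by rewrite mulr_ge0// ltW.
  rewrite mulrC ler_pdivrMr ?ltr_wpDr// mul1r.
  rewrite (bigD1 i)//= addrCA lerDl addr_ge0// sumr_ge0//.
have s'0 : 0 <= s'.
  by apply: (cvgr_to_ge s'P); apply: nearW => k; exact: ltW.
have c0 i : 0 <= c i.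
  by apply: (cvgr_to_ge (cP i)); apply: nearW => k; rewrite mulr_ge0// ltW.
have cact i : G i xb != 0 -> c i = 0.
  move=> Gi; apply: (cvgr_unique _ _ _ _ _ _ _ (cP i)).
  by apply: cvg_near_cst; apply: nearW => k; rewrite bact// mulr0.
have sum1 : s' + \sum_i c i = 1.
  apply: (cvgr_unique _ _ U _ (fun k => s k + \sum_i s k * b k i)).
    by apply: cvgD => //; exact: cvg_sumr.
  apply: cvg_near_cst; apply: nearW => k.
  by rewrite -mulr_sumr -{1}[s k]mulr1 -mulrDr mulVf// gt_eqF// ltr_wpDr.
have key j : \sum_i c i * pd (G i) xb j = s' * v j.
  apply: (cvgr_unique _ _ U _
    (fun k => \sum_i (s k * b k i) * pd (G i) (y k) j)).
    by apply: cvg_sumr => i _; apply: cvgM.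
  have -> : (fun k => \sum_i (s k * b k i) * pd (G i) (y k) j) =
            (fun k => s k * \sum_i a k i * pd (G i) (y k) j).
    apply/funext => k; under eq_bigr do rewrite -mulrA.
    by rewrite -mulr_sumr; have [_ _ -> _] := bP k.
  by apply: cvgM => //; move=> A /av; exact: FU.
(* If [s'] is nonzero, undoing the scaling gives the multipliers [c / s']. If it is zero, [key]
   makes [c] a dependence, nontrivial because its mass is 1; this is to be refuted. *)
have [s'00|s'n0] := eqVneq s' 0; last first.
  exists (fun i => c i / s'); split=> [i|i /cact ->|j].
  - by rewrite divr_ge0.
  - by rewrite mul0r.
  - under eq_bigr do rewrite mulrAC.
    by rewrite -mulr_suml key mulrAC divff// mul1r.
have cI i : i \notin I -> c i = 0.
  move=> iI; apply: (cvgr_unique _ _ _ _ _ _ _ (cP i)).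
  apply: cvg_near_cst; apply: filterS UI => k Ik.
  by move: iI; rewrite -Ik inE negbK => /eqP ->; rewrite mulr0.
have Iact i : i \in I -> G i xb = 0.
  move=> iI; have [k Ik] := filter_ex UI.
  by apply/eqP; apply: contraTT iI => /(bact k) bi; rewrite -Ik inE bi eqxx.
have pld : exists a : 'I_q -> R,
    (forall i, i \in I -> 0 <= a i) /\ (exists2 i, i \in I & a i != 0) /\
    (forall j, \sum_(i in I) a i * pd (G i) xb j = 0).
  exists c; split=> //; split.
    apply: contrapT => cz.
    move: sum1; rewrite s'00 add0r big1 => [/esym/eqP|i _].
      by rewrite oner_eq0.
    have [iI|/cI//] := boolP (i \in I).
    by apply/eqP; apply: contraT => ci; case: cz; exists i.
  move=> j; transitivity (s' * v j); last by rewrite s'00 mul0r.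
  rewrite -key [RHS](bigID [in I])/= [X in _ + X]big1 ?addr0// => i /cI ->.
  by rewrite mul0r.
have dep := Gcpld I Iact pld.
have Udep : \forall k \near U, exists d : 'I_q -> R,
    (exists2 i, i \in I & d i != 0) /\
    (forall j, \sum_(i in I) d i * pd (G i) (y k) j = 0) := yU _ dep.
(* At a single such [k], the dependence on [I] supplied by CPLD contradicts the independence
   obtained from the Caratheodory reduction. *)
have [k [Ik [d [dI d0]]]] := filter_ex (filterI UI Udep).
have [_ _ _ /(_ d)] := bP k.
by rewrite Ik => /(_ dI)/(_ d0).
Qed.

(** * First-order calculus: convexity, squared positive part, augmented Lagrangian *)

Lemma diff_pdE (R : realType) (n : nat) (f : 'rV[R]_n -> R) (x v : 'rV[R]_n) :
  'd f x v = \sum_j v 0 j * pd f x j.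
Proof.
rewrite {1}(row_sum_delta v) linear_sum; apply: eq_bigr => j _.
by rewrite linearZ.
Qed.

(** The first-order remainder is at most [h ^+ 2], by cases on signs, so the difference quotient is
    within [|h|] of the claimed derivative, also at the kink [t = 0]. *)
Lemma is_derive_pospart_sqr (R : realType) (t : R) :
  is_derive t 1 (fun s : R => Num.max 0 s ^+ 2) (2 * Num.max 0 t).
Proof.
have bnd (h : R) : `|Num.max 0 (h + t) ^+ 2 - Num.max 0 t ^+ 2 -
    h * (2 * Num.max 0 t)| <= h ^+ 2.
  by rewrite ler_norml; case: (leP 0 (h + t)); case: (leP 0 t) => ? ?; nra.
pose q (h : R) := h^-1 *: (((fun s : R => Num.max 0 s ^+ 2) \o shift t)
  (h *: (1 : R)) - Num.max 0 t ^+ 2).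
have lim0 : q @ 0^' --> (2 * Num.max 0 t).
  apply/cvgrPdist_le => e e0; near=> h.
  have h0 : h != 0 by near: h; exact: nbhs_dnbhs_neq.
  have he : `|h| <= e by near: h; exact: dnbhs0_le.
  rewrite distrC.
  have -> : q h - 2 * Num.max 0 t =
     h^-1 * (Num.max 0 (h + t) ^+ 2 - Num.max 0 t ^+ 2 - h * (2 * Num.max 0 t)).
    by rewrite /q /= /GRing.scale/= mulr1; field.
  rewrite normrM normfV mulrC ler_pdivrMr ?normr_gt0//.
  apply: (le_trans (bnd h)).
  by rewrite -real_normK ?num_real// expr2 ler_pM.
apply: DeriveDef; first by apply/cvg_ex; exists (2 * Num.max 0 t).
exact: cvg_lim lim0.
Unshelve. all: by end_near. Qed.

(** Convexity bounds the difference quotients at [x] towards [y] by [f y - f x]; let [t] decrease to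
    0. Convexity is asked on one segment only, so that block-convex costs are covered. *)
Lemma gradient_ineq (R : realType) (n : nat) (f : 'rV[R]_n -> R)
    (x y : 'rV[R]_n) :
  differentiable f x ->
  (forall t, 0 <= t -> t <= 1 ->
     f (t *: y + (1 - t) *: x) <= t * f y + (1 - t) * f x) ->
  \sum_j (y 0 j - x 0 j) * pd f x j <= f y - f x.
Proof.
move=> fx fcvx.
have -> : \sum_j (y 0 j - x 0 j) * pd f x j = 'D_(y - x) f x.
  by rewrite deriveE// diff_pdE; apply: eq_bigr => j _; rewrite !mxE.
have /cvg_dnbhs_at_right := @diff_derivable _ _ _ f x (y - x) fx.
move=> /cvgr_to_le; apply.
near=> t.
have t0 : 0 < t by near: t; exact: nbhs_right_gt.
have t1 : t <= 1 by near: t; exact: nbhs_right_le.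
rewrite /= -[_ *: _]/(_ * _) mulrC ler_pdivrMr//.
have := fcvx t (ltW t0) t1.
have -> : t *: y + (1 - t) *: x = t *: (y - x) + x.
  by rewrite scalerBr scalerBl scale1r addrA addrAC.
lra.
Unshelve. all: by end_near. Qed.

Lemma is_diff_pospart_sqr_comp (R : realType) (n : nat) (f : 'rV[R]_n -> R)
    (c : R) (x : 'rV[R]_n) :
  differentiable f x ->
  is_diff x (fun z => Num.max 0 (f z + c) ^+ 2)
    (fun v => 2 * Num.max 0 (f x + c) * 'd f x v).
Proof.
move=> fx.
have dfc : is_diff x (fun z => f z + c) ('d f x).
  apply: is_diff_eq (is_diffD (differentiableP fx) (is_diff_cst c x)) _.
  by rewrite addr0.
have dfc1 : differentiable (fun z => f z + c) x := @ex_diff _ _ _ _ _ _ _ dfc.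
pose phi (s : R) := Num.max 0 s ^+ 2.
have [dphi phi'] := is_derive_pospart_sqr R (f x + c).
have dphi1 : differentiable phi (f x + c) by apply/derivable1_diffP.
have dcomp : differentiable (phi \o (fun z => f z + c)) x.
  exact: (differentiable_comp dfc1 dphi1).
have dphiE (w : R) : 'd phi (f x + c) w = 2 * Num.max 0 (f x + c) * w.
  by rewrite (diff1E dphi1) /= derive1E phi'
    -[LHS]/(w * (2 * Num.max 0 (f x + c))) mulrC.
apply: DiffDef => //; rewrite (diff_comp dfc1 dphi1).
by apply/funext => v /=; rewrite dphiE diff_val.
Qed.

(** For [rho > 0] the weight [rho * Num.max 0 (g i x + u i / rho)] is the updated multiplier, so
    this is the gradient of the ordinary Lagrangian in [g] at the new multiplier. *)
Lemma pd_La (R : realType) (n N m : nat) (theta : 'I_N -> 'rV[R]_n -> R)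
    (g : 'I_m -> 'rV[R]_n -> R) (nu : 'I_N) (u : 'I_m -> R) (rho : R)
    (x : 'rV[R]_n) (j : 'I_n) :
  differentiable (theta nu) x -> (forall i, differentiable (g i) x) ->
  pd (La theta g nu u rho) x j =
  pd (theta nu) x j +
  rho * \sum_i Num.max 0 (g i x + u i / rho) * pd (g i) x j.
Proof.
move=> dth dg.
pose phi i (z : 'rV[R]_n) := Num.max 0 (g i z + u i / rho) ^+ 2.
have dphi i := is_diff_pospart_sqr_comp R n (g i) (u i / rho) x (dg i).
have phi_diff i : differentiable (phi i) x := @ex_diff _ _ _ _ _ _ _ (dphi i).
have S_diff : differentiable (\sum_(i < m) phi i) x.
  exact: differentiable_sum.
have -> : La theta g nu u rho = theta nu + (rho / 2) *: \sum_(i < m) phi i.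
  by apply/funext => z; rewrite /La -[RHS]/(_ + _ * _ z) fct_sumE.
rewrite /pd -deriveE; last first.
  by apply: differentiableD => //; exact: differentiableZ.
rewrite deriveD; [|exact: diff_derivable|]; last first.
  by apply: diff_derivable; exact: differentiableZ.
rewrite deriveZ; last exact: diff_derivable.
rewrite derive_sum; last by move=> i; exact: diff_derivable.
rewrite deriveE// -[_ *: _]/(_ * _) -mulrA !mulr_sumr; congr (_ + _).
apply: eq_bigr => i _.
by rewrite deriveE// (@diff_val _ _ _ _ _ _ _ (dphi i)); field.
Qed.

(** * Limits and asymptotic complementarity *)

Lemma cvgr_dominated0 (R : realType) (T : Type) (F : set_system T)
    (FF : Filter F) (f g : T -> R) :
  (\forall k \near F, `|f k| <= `|g k|) -> g @ F --> 0 -> f @ F --> 0.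
Proof.
move=> fg /cvgrPdist_le g0; apply/cvgrPdist_le => e /g0 ge.
near=> k; rewrite sub0r normrN.
have fgk : `|f k| <= `|g k| by near: k.
have : `|0 - g k| <= e by near: k.
by rewrite sub0r normrN; exact: le_trans.
Unshelve. all: by end_near. Qed.

Lemma cvg_pospart (R : realType) (T : Type) (F : set_system T)
    (FF : Filter F) (f : T -> R) (l : R) :
  f @ F --> l -> (fun k => Num.max 0 (f k)) @ F --> Num.max 0 l.
Proof.
move=> fl.
have -> : (fun k => Num.max 0 (f k)) = (fun k => (f k + `|f k|) / 2).
  by apply/funext => k; rewrite maxr_absE add0r sub0r normrN.
rewrite maxr_absE add0r sub0r normrN; apply: cvgM; last exact: cvg_cst.
by apply: cvgD => //; exact: cvg_norm.
Qed.

(** Here [c] is a slack and [m] a multiplier of either sign. If the limit slack is positive, the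
    minimum is eventually [m]; if it is zero, the negative part of [m] is dominated by the minimum.
    The truncation of [m] is nonnegative and lives on active constraints, as the cone lemma
    requires. *)
Lemma min_cvg0_complementarity (R : realType) (T : Type) (F : set_system T)
    (FF : ProperFilter F) (c m : T -> R) (c0 : R) :
  c @ F --> c0 -> (fun k => Num.min (c k) (m k)) @ F --> 0 ->
  0 <= c0 /\
  (fun k => m k - (if c0 == 0 then Num.max 0 (m k) else 0)) @ F --> 0.
Proof.
move=> cc0 min0.
have c0_ge0 : 0 <= c0.
  have cmin : (fun k => c k - Num.min (c k) (m k)) @ F --> c0 - 0.
    exact: cvgB.
  rewrite -[c0]subr0; apply: (cvgr_to_ge cmin).
  by apply: nearW => k; rewrite subr_ge0 ge_min lexx.
split=> //; apply: (cvgr_dominated0 _ _ _ _ _ _ _ min0).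
have [c00|c0n0] := eqVneq c0 0.
  apply: nearW => k; case: (leP 0 (m k)) => m0; first by rewrite subrr normr0.
  rewrite subr0 !ltr0_norm//; last by rewrite gt_min m0 orbT.
  by rewrite lerN2 ge_min lexx orbT.
have c0_gt0 : 0 < c0 / 2 by rewrite divr_gt0// lt_neqAle eq_sym c0n0.
near=> k.
have ck : `|c0 - c k| < c0 / 2 by near: k; exact: cvgr_dist_lt.
have mk : `|0 - Num.min (c k) (m k)| < c0 / 2 by near: k; exact: cvgr_dist_lt.
rewrite subr0; move: ck mk; rewrite sub0r normrN.
rewrite ltr_norml => /andP[_ ck]; case: (leP (c k) (m k)) => // ckm.
rewrite ltr_norml => /andP[_]; lra.
Unshelve. all: by end_near. Qed.

Lemma CPLD_cone_closed_gh (R : realType) (n m p : nat)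
    (g : 'I_m -> 'rV[R]_n -> R) (h : 'I_p -> 'rV[R]_n -> R)
    (xb : 'rV[R]_n) (T : Type) (F : set_system T) (FF : ProperFilter F)
    (y : T -> 'rV[R]_n) (a : T -> 'I_m -> R) (b : T -> 'I_p -> R)
    (v : 'I_n -> R) :
  (forall i, C1 (g i)) -> (forall l, C1 (h l)) ->
  CPLD (Gmap g h) xb -> y @ F --> xb ->
  (forall k i, 0 <= a k i) -> (forall k l, 0 <= b k l) ->
  (forall k i, g i xb != 0 -> a k i = 0) ->
  (forall k l, h l xb != 0 -> b k l = 0) ->
  (forall j, (fun k => \sum_i a k i * pd (g i) (y k) j +
                       \sum_l b k l * pd (h l) (y k) j) @ F --> v j) ->
  exists (a' : 'I_m -> R) (b' : 'I_p -> R),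
    [/\ forall i, 0 <= a' i, forall l, 0 <= b' l,
        forall i, g i xb != 0 -> a' i = 0,
        forall l, h l xb != 0 -> b' l = 0
      & forall j, \sum_i a' i * pd (g i) xb j + \sum_l b' l * pd (h l) xb j
                  = v j].
Proof.
move=> gC1 hC1 cpld yxb a0 b0 aact bact abv.
pose ab k (i : 'I_(m + p)) :=
  match fintype.split i with inl i => a k i | inr l => b k l end.
have Gl i : Gmap g h (lshift p i) = g i by rewrite /Gmap (unsplitK (inl i)).
have Gr l : Gmap g h (rshift m l) = h l by rewrite /Gmap (unsplitK (inr l)).
have abl k i : ab k (lshift p i) = a k i by rewrite /ab (unsplitK (inl i)).
have abr k l : ab k (rshift m l) = b k l by rewrite /ab (unsplitK (inr l)).
have sumE (c : 'I_(m + p) -> R) (z : 'rV[R]_n) (j : 'I_n) :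
    \sum_i c i * pd (Gmap g h i) z j =
    \sum_i c (lshift p i) * pd (g i) z j + \sum_l c (rshift m l) * pd (h l) z j.
  by rewrite big_split_ord /=; congr (_ + _); apply: eq_bigr => i _;
    rewrite ?Gl ?Gr.
have [|k i|k i|j|c [c0 cact cv]] :=
    CPLD_cone_closed R n (m + p) (Gmap g h) xb T F FF y ab v _ cpld yxb.
- by move=> i; rewrite /Gmap; case: fintype.split.
- by rewrite /ab; case: fintype.split.
- by rewrite /Gmap /ab; case: fintype.split => ?; [exact: aact|exact: bact].
- have -> : (fun k => \sum_i ab k i * pd (Gmap g h i) (y k) j) =
            (fun k => \sum_i a k i * pd (g i) (y k) j +
                      \sum_l b k l * pd (h l) (y k) j); last exact: abv.
    apply/funext => k; rewrite sumE; congr (_ + _); apply: eq_bigr => i _.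
      by rewrite abl.
    by rewrite abr.
exists (fun i => c (lshift p i)), (fun l => c (rshift m l)).
split=> // [i gi|l hl|j]; [|by apply: cact; rewrite Gr|by rewrite -sumE].
by apply: cact; rewrite Gl.
Qed.

(** * Limit points, residual decay and the penalty parameter *)

Lemma enorm_on_coord_le (R : realType) (I : finType) (P : pred I) (v : I -> R)
    (i : I) : P i -> `|v i| <= enorm_on P v.
Proof.
move=> Pi; rewrite -sqrtr_sqr ler_wsqrtr// (bigD1 i)//= lerDl.
by apply: sumr_ge0 => k _; exact: sqr_ge0.
Qed.

(** The filter is generated by tails intersected with preimages of balls around [xb]. The shift
    matches the method, whose conditions hold at [x k.+1]. *)
Lemma limit_point_filter (R : realType) (n : nat) (x : nat -> 'rV[R]_n)
    (xb : 'rV[R]_n) :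
  (forall e : R, 0 < e -> forall K : nat,
     exists2 k : nat, (K <= k)%N & enorm (fun j => x k 0 j - xb 0 j) < e) ->
  exists F : set_system nat,
    [/\ ProperFilter F, \oo `<=` F & (fun k => x k.+1) @ F --> xb].
Proof.
move=> xlim.
pose B (p : nat * R) := [set k | (p.1 <= k)%N /\ ball xb p.2 (x k.+1)].
pose D := [set p : nat * R | 0 < p.2].
have FD : ProperFilter (filter_from D B).
  apply: filter_from_proper; last first.
    (* Asking for an index at least [K.+1] makes it a successor. *)
    move=> [K e] /= e0; have [[|k]//= Kk xk] := xlim e e0 K.+1.
    exists k; split=> //=; split=> // i j; rewrite (ord1 i) /ball/= distrC.
    apply: le_lt_trans xk.
    exact: (enorm_on_coord_le R _ predT (fun j => x k.+1 0 j - xb 0 j) j isT).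
  apply: filter_from_filter; first by exists (0%N, 1); exact: ltr01.
  move=> [K e] [K' e'] /= e0 e'0; exists (maxn K K', Num.min e e') => /=.
    by rewrite /D/= lt_min e0.
  move=> k [/=]; rewrite geq_max => /andP[Kk K'k] xk; split; split=> //=.
    by apply: le_ball xk; rewrite ge_min lexx.
  by apply: le_ball xk; rewrite ge_min lexx orbT.
exists (filter_from D B); split => //.
  move=> A [K _ KA]; exists (K, 1) => /=; first exact: ltr01.
  by move=> k [Kk _]; exact: KA.
apply/cvg_ballP => e e0.
by exists (0%N, e) => // k [].
Qed.

Lemma geometric_decay_cvg0 (R : realType) (tau : R) (e : nat -> R) (K : nat) :
  0 < tau -> tau < 1 -> (forall k, 0 <= e k) ->
  (forall k, (K <= k)%N -> e k.+1 <= tau * e k) -> e @ \oo --> 0.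
Proof.
move=> tau0 tau1 e0 etau; rewrite -(cvg_shiftn K).
have le_geo k : e (k + K)%N <= tau ^+ k * e K.
  elim: k => [|k IH]; first by rewrite expr0 mul1r.
  rewrite addSn exprS -mulrA; apply: le_trans (etau _ (leq_addl _ _)) _.
  by rewrite ler_pM2l.
have geo0 : (fun k => tau ^+ k * e K) @ \oo --> 0.
  rewrite -(mul0r (e K)); apply: cvgM; last exact: cvg_cst.
  by apply: cvg_expr; rewrite ger0_norm// ltW.
apply: cvgr_dominated0 geo0; apply: nearW => k.
by rewrite /= ger0_norm//; apply: (le_trans (le_geo k)); exact: ler_norm.
Qed.

(** Each failed test raises [rho] by at least the fixed amount [rho 0 * (gamma - 1)], so infinitely
    many failures make it unbounded. *)
Lemma penalty_dichotomy (R : realType) (gamma : R) (rho : nat -> R)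
    (test : nat -> bool) :
  1 < gamma -> 0 < rho 0%N ->
  (forall k, rho k.+1 = if test k then rho k else gamma * rho k) ->
  (forall k, 0 < rho k) /\
  ((exists K, forall k, (K <= k)%N -> test k) \/
   (fun k => (rho k)^-1) @ \oo --> 0).
Proof.
move=> gamma1 rho0 rhoS.
have rho_gt0 k : 0 < rho k.
  elim: k => // k IH; rewrite rhoS; case: ifP => // _.
  by rewrite mulr_gt0// (lt_trans ltr01).
split=> //; have [?|/forallNP ntest] :=
  pselect (exists K, forall k, (K <= k)%N -> test k); [by left|right].
have rho_nd : {homo rho : k l / (k <= l)%N >-> k <= l}.
  apply: homo_leq => [//|? ? ?|k]; first exact: le_trans.
  rewrite rhoS; case: ifP => // _.
  by rewrite ler_peMl ?ltW.
have rho_big N : exists K, rho 0%N * (gamma - 1) * N%:R <= rho K.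
  elim: N => [|N [K rhoK]]; first by exists 0%N; rewrite mulr0 ltW.
  have /existsNP[k /not_implyP[Kk /negP ntk]] := ntest K.
  exists k.+1; rewrite rhoS (negPf ntk).
  have := rho_nd _ _ Kk; have := rho_nd _ _ (leq0n k).
  rewrite -addn1 natrD mulrDr mulr1; nra.
apply/cvgrPdist_le => e e0.
have c0 : 0 < rho 0%N * (gamma - 1) by rewrite mulr_gt0// subr_gt0.
have [K rhoK] := rho_big (Num.bound (e^-1 / (rho 0%N * (gamma - 1)))).
exists K => // k /= Kk; rewrite sub0r normrN gtr0_norm ?invr_gt0//.
rewrite -[e]invrK lef_pV2 ?posrE ?invr_gt0//.
apply: le_trans (rho_nd _ _ Kk); apply: le_trans rhoK.
rewrite mulrC -ler_pdivrMr//; apply/ltW/archi_boundP.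
by rewrite divr_ge0 ?invr_ge0// ltW.
Qed.

(** * From stationarity to feasibility and optimality by convexity *)

Lemma multiplier_gradient_ineq (R : realType) (n m : nat)
    (g : 'I_m -> 'rV[R]_n -> R) (a : 'I_m -> R) (x y : 'rV[R]_n) :
  (forall i, C1 (g i)) -> (forall i, convex_fun (g i)) ->
  (forall i, 0 <= a i) ->
  \sum_j (y 0 j - x 0 j) * (\sum_i a i * pd (g i) x j) <=
  \sum_i a i * (g i y - g i x).
Proof.
move=> gC1 gcvx a0; under eq_bigr do rewrite mulr_sumr.
rewrite exchange_big /=; apply: ler_sum => i _.
under eq_bigr do rewrite mulrCA.
rewrite -mulr_sumr ler_wpM2l//; apply: gradient_ineq; first exact: (gC1 i).1.
by move=> t t0 t1; exact: gcvx.
Qed.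

(** A constraint with [g i x = 0] cannot increase to first order towards a point where it is
    nonpositive. This also serves at an [x] whose feasibility is still to be proved. *)
Lemma multiplier_descent (R : realType) (n m : nat)
    (g : 'I_m -> 'rV[R]_n -> R) (a : 'I_m -> R) (x y : 'rV[R]_n) :
  (forall i, C1 (g i)) -> (forall i, convex_fun (g i)) ->
  (forall i, 0 <= a i) -> (forall i, g i x != 0 -> a i = 0) ->
  (forall i, g i y <= 0) ->
  \sum_j (y 0 j - x 0 j) * (\sum_i a i * pd (g i) x j) <= 0.
Proof.
move=> gC1 gcvx a0 aact gy.
apply: le_trans (multiplier_gradient_ineq _ _ _ _ _ _ _ gC1 gcvx a0) _.
apply: sumr_le0 => i _; have [gx|/aact ->] := eqVneq (g i x) 0.
  by rewrite gx subr0 mulr_ge0_le0.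
by rewrite mul0r.
Qed.

(* [x] is a KKT point of the convex program of minimizing ||g_+||^2 / 2 subject
   to [h <= 0] and to the constraints [g i <= 0] that are active at [x]. *)
Lemma stationary_feasible (R : realType) (n m p : nat)
    (g : 'I_m -> 'rV[R]_n -> R) (h : 'I_p -> 'rV[R]_n -> R)
    (a : 'I_m -> R) (b : 'I_p -> R) (x y : 'rV[R]_n) :
  (forall i, C1 (g i)) -> (forall l, C1 (h l)) ->
  (forall i, convex_fun (g i)) -> (forall l, convex_fun (h l)) ->
  (forall i, 0 <= a i) -> (forall l, 0 <= b l) ->
  (forall i, g i x != 0 -> a i = 0) -> (forall l, h l x != 0 -> b l = 0) ->
  (forall j, \sum_i a i * pd (g i) x j + \sum_l b l * pd (h l) x j =
             - \sum_i Num.max 0 (g i x) * pd (g i) x j) ->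
  feasible g h y -> forall i, g i x <= 0.
Proof.
move=> gC1 hC1 gcvx hcvx a0 b0 aact bact stat [gy hy].
have pos0 i : 0 <= Num.max 0 (g i x) by rewrite le_max lexx.
have ad := multiplier_descent _ _ _ _ _ _ y gC1 gcvx a0 aact gy.
have hd := multiplier_descent _ _ _ _ _ _ y hC1 hcvx b0 bact hy.
have gd := multiplier_gradient_ineq _ _ _ _ _ x y gC1 gcvx pos0.
have : \sum_j (y 0 j - x 0 j) * (\sum_i Num.max 0 (g i x) * pd (g i) x j) =
       - (\sum_j (y 0 j - x 0 j) * (\sum_i a i * pd (g i) x j) +
          \sum_j (y 0 j - x 0 j) * (\sum_l b l * pd (h l) x j)).
  rewrite -big_split -sumrN; apply: eq_bigr => j _ /=.
  by rewrite -mulrDr stat mulrN opprK.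
set A := \sum_j _ in gd *; set B := \sum_j _ in hd *.
set C := \sum_j _ in ad * => ABC.
have sq_le : \sum_i Num.max 0 (g i x) * (g i y - g i x) <=
    - \sum_i Num.max 0 (g i x) ^+ 2.
  rewrite -sumrN; apply: ler_sum => i _; have := gy i.
  by case: (leP 0 (g i x)) => gx ?; nra.
(* Stationarity and the two descent inequalities make the left side of [gd] nonnegative, while
   [sq_le] bounds its right side by minus this sum. *)
have sq0 : \sum_i Num.max 0 (g i x) ^+ 2 = 0.
  apply/eqP; rewrite eq_le sumr_ge0 ?andbT => [|i _]; last exact: sqr_ge0.
  by lra.
move=> i; have gi0 : Num.max 0 (g i x) ^+ 2 = 0.
  by apply: (psumr_eq0P _ sq0) => // k _; exact: sqr_ge0.
by move/eqP: gi0; rewrite sqrf_eq0 => /eqP <-; rewrite le_max lexx orbT.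
Qed.

(** The KKT system stacks the players: row [j] uses the cost of the owner of [j]. A deviation of
    [nu] moves only the coordinates of its own block, where that cost is [theta nu]. *)
Lemma KKT_GNEP_solution (R : realType) (n N m p : nat) (blk : 'I_n -> 'I_N)
    (theta : 'I_N -> 'rV[R]_n -> R) (g : 'I_m -> 'rV[R]_n -> R)
    (h : 'I_p -> 'rV[R]_n -> R) (a : 'I_m -> R) (b : 'I_p -> R)
    (x : 'rV[R]_n) :
  (forall nu, C1 (theta nu)) ->
  (forall i, C1 (g i)) -> (forall l, C1 (h l)) ->
  (forall i, convex_fun (g i)) -> (forall l, convex_fun (h l)) ->
  (forall nu, convex_in_block blk nu (theta nu)) ->
  (forall i, 0 <= a i) -> (forall l, 0 <= b l) ->
  (forall i, g i x != 0 -> a i = 0) -> (forall l, h l x != 0 -> b l = 0) ->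
  (forall j, \sum_i a i * pd (g i) x j + \sum_l b l * pd (h l) x j =
             - pd (theta (blk j)) x j) ->
  feasible g h x -> GNEP_solution blk theta g h x.
Proof.
move=> thC1 gC1 hC1 gcvx hcvx thcvx a0 b0 aact bact kkt xfeas.
split=> // nu y yx [gy hy].
have gd := multiplier_descent _ _ _ _ _ _ y gC1 gcvx a0 aact gy.
have hd := multiplier_descent _ _ _ _ _ _ y hC1 hcvx b0 bact hy.
have thd : \sum_j (y 0 j - x 0 j) * pd (theta nu) x j <=
           theta nu y - theta nu x.
  apply: gradient_ineq; first exact: (thC1 nu).1.
  by move=> t t0 t1; exact: thcvx.
have : \sum_j (y 0 j - x 0 j) * pd (theta nu) x j =
    - (\sum_j (y 0 j - x 0 j) * (\sum_i a i * pd (g i) x j) +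
       \sum_j (y 0 j - x 0 j) * (\sum_l b l * pd (h l) x j)).
  rewrite -big_split -sumrN; apply: eq_bigr => j _ /=.
  have [jnu|/yx ->] := eqVneq (blk j) nu; last first.
    by rewrite subrr !mul0r addr0 oppr0.
  by rewrite -mulrDr kkt jnu mulrN opprK.
set A := \sum_j _ in thd *; set B := \sum_j _ in gd *.
set C := \sum_j _ in hd * => ABC; lra.
Qed.

(** * Convergence of the method *)

Lemma cvgr_ext (R : realType) (T : Type) (F : set_system T) (f g : T -> R)
    (a b : R) : f @ F --> a -> f =1 g -> a = b -> g @ F --> b.
Proof. by move=> fa /funext <- <-. Qed.

Lemma coord_cvg0_of_enorm_on (R : realType) (I : finType) (T : Type)
    (F : set_system T) (FF : Filter F) (P : pred I) (v : T -> I -> R)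
    (e : T -> R) (i : I) :
  P i -> (forall k, enorm_on P (v k) <= e k) -> e @ F --> 0 ->
  (fun k => v k i) @ F --> 0.
Proof.
move=> Pi ve e0; apply: (cvgr_dominated0 _ _ _ _ _ e) e0; apply: nearW => k.
apply: le_trans (ler_norm _); apply: le_trans (ve k).
exact: enorm_on_coord_le.
Qed.

Lemma weighted_gradients_cvg0 (R : realType) (n m : nat)
    (g : 'I_m -> 'rV[R]_n -> R) (xb : 'rV[R]_n) (T : Type)
    (F : set_system T) (FF : ProperFilter F) (y : T -> 'rV[R]_n)
    (a : T -> 'I_m -> R) (a' : 'I_m -> R) (j : 'I_n) :
  (forall i, C1 (g i)) -> y @ F --> xb ->
  (forall i, (fun k => a k i) @ F --> a' i) ->
  (fun k => \sum_i a k i * pd (g i) (y k) j) @ F -->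
  \sum_i a' i * pd (g i) xb j.
Proof.
move=> gC1 yxb aa'; apply: cvg_sumr => i _; apply: cvgM => //.
exact: cvg_comp yxb ((gC1 i).2 j xb).
Qed.

Theorem theorem5p4 (R : realType) (n N m p : nat) (blk : 'I_n -> 'I_N)
  (theta : 'I_N -> 'rV[R]_n -> R) (g : 'I_m -> 'rV[R]_n -> R)
  (h : 'I_p -> 'rV[R]_n -> R)
  (* standing assumptions *)
  (Htheta_C1 : forall nu, C1 (theta nu))
  (Hg_C1 : forall i, C1 (g i)) (Hh_C1 : forall l, C1 (h l))
  (Hg_cvx : forall i, convex_fun (g i)) (Hh_cvx : forall l, convex_fun (h l))
  (Htheta_cvx : forall nu, convex_in_block blk nu (theta nu))
  (* parameters of the method *)
  (umax tau gamma : R) (Humax : 0 <= umax) (Htau0 : 0 < tau) (Htau1 : tau < 1)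
  (Hgamma : 1 < gamma)
  (* iterates *)
  (x : nat -> 'rV[R]_n) (lam u : nat -> 'I_m -> R) (mu : nat -> 'I_p -> R)
  (rho eps eps' : nat -> R)
  (Hrho0 : 0 < rho 0%N)
  (Hu0 : forall i, 0 <= u 0%N i <= umax)
  (* inexactness assumption *)
  (Heps_ge0 : forall k, 0 <= eps k) (Heps'_ge0 : forall k, 0 <= eps' k)
  (Heps_noninc : forall k, eps k.+1 <= eps k)
  (Heps_cvg : eps @ \oo --> 0) (Heps'_cvg : eps' @ \oo --> 0)
  (Hinex1 : forall k nu,
     enorm_on (fun j => blk j == nu)
       (fun j => pd (La theta g nu (u k) (rho k)) (x k.+1) j
                 + \sum_l mu k.+1 l * pd (h l) (x k.+1) j) <= eps k)
  (Hinex2 : forall k,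
     enorm (fun l => Num.min (- h l (x k.+1)) (mu k.+1 l)) <= eps' k)
  (* multiplier update *)
  (Hlam : forall k i, lam k.+1 i = Num.max 0 (u k i + rho k * g i (x k.+1)))
  (* penalty update *)
  (Hrho : forall k,
     rho k.+1 =
       if enorm (fun i => Num.min (- g i (x k.+1)) (lam k.+1 i))
            <= tau * enorm (fun i => Num.min (- g i (x k)) (lam k i))
       then rho k else gamma * rho k)
  (* safeguarded multiplier update *)
  (Hu : forall k i, u k.+1 i = Num.min (lam k.+1 i) umax)
  (* limit point *)
  (xb : 'rV[R]_n)
  (Hlimpt : forall e : R, 0 < e -> forall K : nat,
     exists2 k : nat, (K <= k)%N & enorm (fun j => x k 0 j - xb 0 j) < e)
  (* feasible set nonempty, CPLD at xb *)
  (Hfeas : exists y, feasible g h y)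
  (Hcpld : CPLD (Gmap g h) xb) :
  feasible g h xb /\ GNEP_solution blk theta g h xb.
Proof.
pose y k := x k.+1.
have [F [FF ooF yF]] : exists F : set_system nat,
    [/\ ProperFilter F, \oo `<=` F & y @ F --> xb].
  exact: limit_point_filter Hlimpt.
pose res k := enorm (fun i => Num.min (- g i (x k)) (lam k i)).
have [rho_gt0 rho_case] := penalty_dichotomy R gamma rho
  (fun k => res k.+1 <= tau * res k) Hgamma Hrho0 Hrho.
have sumDB q (s t c : 'I_q -> R) :
    \sum_i (s i - t i) * c i = \sum_i s i * c i - \sum_i t i * c i.
  by rewrite -sumrB; apply: eq_bigr => i _; rewrite mulrBl.
have epsF : eps @ F --> 0 by move=> A /Heps_cvg; exact: ooF.
have eps'F : eps' @ F --> 0 by move=> A /Heps'_cvg; exact: ooF.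
have contF (f : 'rV[R]_n -> R) : {for xb, continuous f} ->
    (fun k => f (y k)) @ F --> f xb.
  by move=> fc; exact: (cvg_comp _ f yF fc).
have gF i : (fun k => g i (y k)) @ F --> g i xb.
  exact/contF/differentiable_continuous/(Hg_C1 i).1.
have hF l : (fun k => h l (y k)) @ F --> h l xb.
  exact/contF/differentiable_continuous/(Hh_C1 l).1.
have thF nu j : (fun k => pd (theta nu) (y k) j) @ F --> pd (theta nu) xb j.
  exact: (contF _ ((Htheta_C1 nu).2 j xb)).
have minh l : (fun k => Num.min (- h l (y k)) (mu k.+1 l)) @ F --> 0.
  exact: (coord_cvg0_of_enorm_on R _ _ F _ predT
    (fun k l => Num.min (- h l (y k)) (mu k.+1 l)) eps' l isT Hinex2 eps'F).
(* [mu'] is an admissible multiplier for the cone lemma, asymptotically equal to [mu], which may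
   itself have negative entries. *)
pose mu' k l := if - h l xb == 0 then Num.max 0 (mu k.+1 l) else 0.
have hcompl l : 0 <= - h l xb /\ (fun k => mu k.+1 l - mu' k l) @ F --> 0.
  exact: min_cvg0_complementarity (cvgN (hF l)) (minh l).
have hb l : h l xb <= 0 by rewrite -oppr_ge0; case: (hcompl l).
have mu'F l : (fun k => mu k.+1 l - mu' k l) @ F --> 0 by case: (hcompl l).
have mu'0 k l : 0 <= mu' k l by rewrite /mu'; case: ifP; rewrite // le_max lexx.
have mu'act k l : h l xb != 0 -> mu' k l = 0.
  by rewrite /mu' oppr_eq0 => /negPf ->.
pose w k i := Num.max 0 (g i (y k) + u k i / rho k).
have lamE k i : lam k.+1 i = rho k * w k i.
  rewrite Hlam maxr_pMr ?ltW// mulr0 mulrDr; congr (Num.max _ _).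
  by rewrite addrC [rho k * (_ / _)]mulrCA divff ?mulr1// gt_eqF.
have lam_ge0 k i : 0 <= lam k.+1 i by rewrite Hlam le_max lexx.
have u_itv k i : 0 <= u k i <= umax.
  case: k => // k; rewrite Hu le_min lam_ge0 Humax/=.
  by rewrite ge_min lexx orbT.
(* Stacked Lagrangian residual of all players; the inexactness bound for the owner of [j] controls
   its entry [j]. *)
pose r k j := pd (theta (blk j)) (y k) j +
  \sum_i lam k.+1 i * pd (g i) (y k) j + \sum_l mu k.+1 l * pd (h l) (y k) j.
have rF j : (fun k => r k j) @ F --> 0.
  apply: (coord_cvg0_of_enorm_on R _ _ F _ (fun j' => blk j' == blk j)
    r eps j (eqxx _) _ epsF) => k.
  apply: le_trans (Hinex1 k (blk j)); rewrite le_eqVlt; apply/orP; left.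
  apply/eqP; congr Num.sqrt; apply: eq_bigr => j' /eqP jj'.
  congr (_ ^+ 2).
  rewrite pd_La; [|exact: (Htheta_C1 _).1|by move=> i; exact: (Hg_C1 i).1].
  rewrite /r jj' mulr_sumr; congr (_ + _ + _).
  by apply: eq_bigr => i _; rewrite lamE mulrA.
pose lam' k i := if - g i xb == 0 then Num.max 0 (lam k.+1 i) else 0.
have [gb lam'F] : (forall i, g i xb <= 0) /\
    (forall i, (fun k => lam k.+1 i - lam' k i) @ F --> 0).
  (* If the test eventually always passes, the residual decays geometrically and gives both claims
     through complementarity. Otherwise [rho] tends to infinity. *)
  case: rho_case => [[K resK]|rhoV0].
    have res0 : res @ \oo --> 0.
      by apply: (geometric_decay_cvg0 R tau res K) => // k; exact: sqrtr_ge0.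
    have resF : (fun k => res k.+1) @ F --> 0.
      have resS0 : (fun k => res k.+1) @ \oo --> 0 by rewrite (cvg_shiftS res).
      by move=> A /resS0; exact: ooF.
    have ming i : (fun k => Num.min (- g i (y k)) (lam k.+1 i)) @ F --> 0.
      exact: (coord_cvg0_of_enorm_on R _ _ F _ predT
        (fun k i => Num.min (- g i (y k)) (lam k.+1 i)) (fun k => res k.+1)
        i isT (fun k => lexx _) resF).
    have gcompl i : 0 <= - g i xb /\ (fun k => lam k.+1 i - lam' k i) @ F --> 0.
      exact: min_cvg0_complementarity (cvgN (gF i)) (ming i).
    by split=> i; have [] := gcompl i; rewrite ?oppr_ge0.
  have rhoVF : (fun k => (rho k)^-1) @ F --> 0 by move=> A /rhoV0; exact: ooF.
  have guF i : (fun k => g i (y k) + u k i / rho k) @ F --> g i xb.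
    rewrite -[g i xb]addr0; apply: cvgD => //.
    have ub0 : (fun k => umax * (rho k)^-1) @ F --> 0.
      by rewrite -(mulr0 umax); apply: cvgM => //; exact: cvg_cst.
    apply: cvgr_dominated0 ub0; apply: nearW => k.
    have /andP[uk0 uk1] := u_itv k i.
    have rk0 := ltW (rho_gt0 k).
    rewrite ger0_norm ?divr_ge0// ger0_norm ?divr_ge0//.
    by rewrite ler_pM2r ?invr_gt0.
  have wF i : (fun k => w k i) @ F --> Num.max 0 (g i xb) by exact: cvg_pospart.
  have gb : forall i, g i xb <= 0.
    have mu'rho0 k l : 0 <= mu' k l / rho k by rewrite divr_ge0// ltW.
    have mu'rhoact k l : h l xb != 0 -> mu' k l / rho k = 0.
      by move=> /(mu'act k) ->; rewrite mul0r.
    (* Division of [r] by [rho] removes the costs and turns [lam] into [w], which tends to the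
       positive part of [g] at [xb]. That term goes to the right-hand side, so the approximating
       combinations use only gradients of [h]. *)
    have [j|a [b [a0 b0 aact bact stat]]] := CPLD_cone_closed_gh R n m p g h xb
      nat F FF y (fun _ _ => 0) (fun k l => mu' k l / rho k)
      (fun j => - \sum_i Num.max 0 (g i xb) * pd (g i) xb j)
      Hg_C1 Hh_C1 Hcpld yF (fun _ _ => lexx 0) mu'rho0 (fun _ _ _ => erefl)
      mu'rhoact.
      have lim : (fun k => (rho k)^-1 * r k j -
            (rho k)^-1 * pd (theta (blk j)) (y k) j -
            \sum_i w k i * pd (g i) (y k) j -
            (rho k)^-1 * \sum_l (mu k.+1 l - mu' k l) * pd (h l) (y k) j) @ F -->
          0 * 0 - 0 * pd (theta (blk j)) xb j -
          \sum_i Num.max 0 (g i xb) * pd (g i) xb j -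
          0 * \sum_(l < p) 0 * pd (h l) xb j.
        apply: cvgB; [apply: cvgB; [apply: cvgB; exact: cvgM|]|].
          exact: (weighted_gradients_cvg0 _ _ _ _ _ _ _ _ y w).
        apply: cvgM => //.
        exact: (weighted_gradients_cvg0 _ _ _ _ _ _ _ _ y
          (fun k l => mu k.+1 l - mu' k l) (fun=> 0)).
      apply: cvgr_ext lim _ _ => [k|]; last by rewrite !mul0r !subr0 sub0r.
      rewrite [in RHS]big1 => [|i _]; last by rewrite mul0r.
      have -> : \sum_i w k i * pd (g i) (y k) j =
          (rho k)^-1 * \sum_i lam k.+1 i * pd (g i) (y k) j.
        rewrite mulr_sumr; apply: eq_bigr => i _.
        by rewrite lamE !mulrA mulVf ?mul1r// gt_eqF.
      have -> : \sum_l mu' k l / rho k * pd (h l) (y k) j =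
          (rho k)^-1 * \sum_l mu' k l * pd (h l) (y k) j.
        rewrite mulr_sumr; apply: eq_bigr => l _.
        by rewrite mulrA (mulrC (mu' k l)).
      rewrite /r sumDB; ring.
    have [z zfeas] := Hfeas.
    exact: (stationary_feasible R n m p g h a b xb z).
  (* For active [i] the truncation changes nothing, as [lam] is nonnegative; for inactive [i], since
     [u] is bounded, [g i + u i / rho] is eventually negative and [lam] vanishes. *)
  split=> // i; have [gi0|gin0] := eqVneq (g i xb) 0.
    apply: cvg_near_cst; apply: nearW => k.
    by rewrite /lam' gi0 oppr0 eqxx max_r// subrr.
  have gi_lt0 : g i xb < 0 by rewrite lt_neqAle gin0 gb.
  apply: cvg_near_cst; near=> k.
  have : g i (y k) + u k i / rho k < 0.
    by near: k; exact: (cvgr_lt (g i xb)).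
  by move=> /ltW guk; rewrite /lam' oppr_eq0 (negPf gin0) subr0 lamE /w
    max_l// mulr0.
have lam'0 k i : 0 <= lam' k i.
  by rewrite /lam'; case: ifP; rewrite // le_max lexx.
have lam'act k i : g i xb != 0 -> lam' k i = 0.
  by rewrite /lam' oppr_eq0 => /negPf ->.
(* Replacing [lam], [mu] by [lam'], [mu'] in [r] costs only vanishing terms, so the combinations of
   active gradients tend to minus the stacked cost gradients. *)
have [j|a [b [a0 b0 aact bact kkt]]] := CPLD_cone_closed_gh R n m p g h xb nat F
    FF y lam' mu' (fun j => - pd (theta (blk j)) xb j) Hg_C1 Hh_C1 Hcpld yF
    lam'0 mu'0 lam'act mu'act.
  have lim : (fun k => r k j - pd (theta (blk j)) (y k) j -
        \sum_i (lam k.+1 i - lam' k i) * pd (g i) (y k) j -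
        \sum_l (mu k.+1 l - mu' k l) * pd (h l) (y k) j) @ F -->
      0 - pd (theta (blk j)) xb j - \sum_(i < m) 0 * pd (g i) xb j -
      \sum_(l < p) 0 * pd (h l) xb j.
    apply: cvgB; [apply: cvgB; [exact: cvgB|]|].
      exact: (weighted_gradients_cvg0 _ _ _ _ _ _ _ _ y
        (fun k i => lam k.+1 i - lam' k i) (fun=> 0)).
    exact: (weighted_gradients_cvg0 _ _ _ _ _ _ _ _ y
      (fun k l => mu k.+1 l - mu' k l) (fun=> 0)).
  apply: cvgr_ext lim _ _ => [k|]; first by rewrite /r !sumDB; ring.
  by rewrite !big1 ?subr0 ?sub0r// => i _; rewrite mul0r.
by split=> //; apply: (KKT_GNEP_solution R n N m p blk theta g h a b).
Unshelve. all: by end_near. Qed.
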